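(* Let $f:\mathbb{R}_+\to\mathbb{R}_+$ be a convex function with $f(1)=0$ that grows at most polynomially, and let $M,L\in\mathcal{L}$. Then $$\overline{D}_f(L\|M)=\overline{D}_f(L_\pi\|M_\pi).$$ In particular, if $M\in\mathcal{L}(\pi)$ and $L\in\mathcal{L}$, then $$\overline{D}_f(L\|M)=\overline{D}_f(L_\pi\|M).$$
   Context: $\mathcal{X}$ is a finite set and $\pi$ is a fixed probability distribution on $\mathcal{X}$ with $\pi(x)>0$ for all $x$. $\mathcal{L}$ is the set of Markov infinitesimal generators on $\mathcal{X}$, i.e. $\mathcal{X}\times\mathcal{X}$ real matrices with non-negative off-diagonal entries and all row sums zero. $\mathcal{L}(\pi)\subseteq\mathcal{L}$ is the set of $\pi$-reversible generators, i.e. those $M$ with $\pi(x)M(x,y)=\pi(y)M(y,x)$ for all $x,y$. The $\pi$-dual $L_\pi$ of $L\in\mathcal{L}$ is the generator with off-diagonal entries $L_\pi(x,y)=\frac{\pi(y)}{\pi(x)}L(y,x)$, $x\neq y$, and diagonal entries such that all row sums are zero. For $M,L\in\mathcal{L}$ the $f$-divergence is $$D_f(M\|L):=\sum_{x\in\mathcal{X}}\pi(x)\sum_{y\in\mathcal{X}\setminus\{x\}}L(x,y)\,f\!\left(\frac{M(x,y)}{L(x,y)}\right),$$ with the convention $0f(a/0)=0$ for $a\ge 0$. Moreover $$\overline{D}_f(L\|M):=D_f\!\left(L\,\Big\|\,\tfrac12(L+M)\right).$$ *)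

(* Defs.v *)
From mathcomp Require Import all_boot all_order all_algebra.
From mathcomp Require Import all_classical all_reals all_analysis.
Import Order.TTheory GRing.Theory Num.Theory.
Import numFieldNormedType.Exports.
Set Implicit Arguments.
Unset Strict Implicit.
Unset Printing Implicit Defensive.
Local Open Scope classical_set_scope.
Local Open Scope ring_scope.

Definition positive_distribution (R : realType) (X : finType) (pi : X -> R) :=
  (forall x, 0 < pi x) /\ \sum_x pi x = 1.

Definition generator (R : realType) (X : finType) (M : X -> X -> R) :=
  (forall x y, x != y -> 0 <= M x y) /\ (forall x, \sum_y M x y = 0).

Definition reversible_generator (R : realType) (X : finType) (pi : X -> R)
    (M : X -> X -> R) :=
  generator M /\ forall x y, pi x * M x y = pi y * M y x.

Definition dual (R : realType) (X : finType) (pi : X -> R) (L : X -> X -> R)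
    (x y : X) : R :=
  if x == y then - \sum_(z | z != x) pi z / pi x * L z x
  else pi y / pi x * L y x.

(* The convention 0 f(a/0) = 0 is automatic: division is total and the factor
   L x y vanishes. *)
Definition fdiv (R : realType) (X : finType) (pi : X -> R) (f : R -> R)
    (M L : X -> X -> R) : R :=
  \sum_x pi x * \sum_(y | y != x) L x y * f (M x y / L x y).

Definition fdiv_mid (R : realType) (X : finType) (pi : X -> R) (f : R -> R)
    (L M : X -> X -> R) : R :=
  fdiv pi f L (fun x y => 2^-1 * (L x y + M x y)).

(* Functions from [0, +oo[ to itself are represented by functions on R whose
   values at negative arguments are irrelevant. *)
Definition convex_on_nonneg (R : realType) (f : R -> R) :=
  convex_function (`[0, +oo[%classic : set (convex_lmodType R^o)) f.

Definition polynomial_growth (R : realType) (f : R -> R) :=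
  exists (n : nat) (C : R), \forall t \near +oo%R, f t <= C * t ^+ n.

Lemma generator_dual (R : realType) (X : finType) (pi : X -> R)
    (L : X -> X -> R) :
  positive_distribution pi -> generator L -> generator (dual pi L).
Proof.
move=> [pi_gt0 _] [L_ge0 _]; split=> [x y xy|x].
  rewrite /dual (negbTE xy) mulr_ge0 //; last by apply: L_ge0; rewrite eq_sym.
  by rewrite divr_ge0 // ltW.
rewrite (bigD1 x)//= {1}/dual eqxx addrC; apply/eqP; rewrite subr_eq0; apply/eqP.
by apply: eq_bigr => y yx; rewrite /dual eq_sym (negbTE yx).
Qed.

Lemma generator_mid (R : realType) (X : finType) (L M : X -> X -> R) :
  generator L -> generator M ->
  generator (fun x y => 2^-1 * (L x y + M x y)).
Proof.
move=> [L0 LS] [M0 MS]; split=> [x y xy|x].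
  by rewrite mulr_ge0 ?invr_ge0// addr_ge0 ?L0 ?M0.
by rewrite -mulr_sumr big_split/= LS MS addr0 mulr0.
Qed.

(* Main.v *)
Require Import Defs.
From mathcomp Require Import all_boot all_order all_algebra.
From mathcomp Require Import all_classical all_reals all_analysis.
Import GRing.Theory Num.Theory.
Local Open Scope ring_scope.

(** The divergence is a sum over ordered pairs of distinct states [x], [y], and
    passing to the [pi]-dual merely reverses every pair.  Indeed duality
    multiplies the rates [M y x] and [L y x] by the same nonzero factor
    [pi y / pi x]: the ratio inside [f] is that of the reversed pair, and the
    weight [pi x] in front turns into [pi y].  Hence [fdiv] takes the same
    value on a pair of rate matrices and on their duals ([fdiv_dual]).

    Since off-diagonal rates are dualised linearly, the midpoint of two duals
    agrees off the diagonal with the dual of the midpoint, and the divergence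
    only sees off-diagonal rates ([eq_fdiv]); so the invariance passes to
    [fdiv_mid].  A reversible [M] agrees with its dual off the diagonal by
    detailed balance, which gives the second identity. *)

Lemma eq_fdiv (R : realType) (X : finType) (pi : X -> R) (f : R -> R)
    (M M' L L' : X -> X -> R) :
  (forall x y, x != y -> M x y = M' x y) ->
  (forall x y, x != y -> L x y = L' x y) ->
  fdiv pi f M L = fdiv pi f M' L'.
Proof.
move=> eqM eqL; apply: eq_bigr => x _; congr (_ * _).
by apply: eq_bigr => y yx; rewrite eqM ?eqL // eq_sym.
Qed.

Lemma dual_offdiag (R : realType) (X : finType) (pi : X -> R)
    (L : X -> X -> R) (x y : X) :
  x != y -> dual pi L x y = pi y / pi x * L y x.
Proof. by move=> xy; rewrite /dual (negbTE xy). Qed.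

Lemma dual_reversible (R : realType) (X : finType) (pi : X -> R)
    (M : X -> X -> R) (x y : X) :
  (forall z, pi z != 0) -> (forall u v, pi u * M u v = pi v * M v u) ->
  x != y -> dual pi M x y = M x y.
Proof.
move=> pi_neq0 balance xy.
by rewrite dual_offdiag // mulrAC -balance mulrAC divff // mul1r.
Qed.

(** Exchanging the names of the two states in the double sum turns the term of
    the dual pair into the original one: the factor [pi y / pi x] cancels in the
    argument of [f], also when [L y x = 0] thanks to [0^-1 = 0], and outside
    [f] it changes the weight [pi x] into [pi y]. *)
Lemma fdiv_dual (R : realType) (X : finType) (pi : X -> R) (f : R -> R)
    (M L : X -> X -> R) :
  (forall x, pi x != 0) ->
  fdiv pi f (dual pi M) (dual pi L) = fdiv pi f M L.
Proof.
move=> pi_neq0; rewrite /fdiv.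
under eq_bigr do rewrite mulr_sumr.
under [RHS]eq_bigr do rewrite mulr_sumr.
rewrite [RHS](exchange_big_dep predT) //=.
apply: eq_bigr => x _.
under [RHS]eq_bigl do rewrite eq_sym.
apply: eq_bigr => y yx.
have xy : x != y by rewrite eq_sym.
rewrite !dual_offdiag // -mulf_div divff ?mul1r; last first.
  by rewrite mulf_neq0 ?invr_neq0.
by rewrite !mulrA [pi x * _]mulrC mulfK.
Qed.

Lemma fdiv_mid_dual (R : realType) (X : finType) (pi : X -> R) (f : R -> R)
    (L M : X -> X -> R) :
  (forall x, pi x != 0) ->
  fdiv_mid pi f (dual pi L) (dual pi M) = fdiv_mid pi f L M.
Proof.
move=> pi_neq0; rewrite /fdiv_mid -[RHS]fdiv_dual //.
apply: eq_fdiv => // x y xy.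
by rewrite !dual_offdiag // -mulrDr mulrCA.
Qed.

Theorem theorem3p2 (R : realType) (X : finType) (pi : X -> R)
    (hpi : positive_distribution pi)
    (f : R -> R)
    (f_ge0 : forall t, 0 <= t -> 0 <= f t)
    (f_convex : convex_on_nonneg f)
    (f1 : f 1 = 0)
    (f_growth : polynomial_growth f)
    (M L : X -> X -> R) (hM : generator M) (hL : generator L) :
  fdiv_mid pi f L M = fdiv_mid pi f (dual pi L) (dual pi M) /\
  (reversible_generator pi M ->
     fdiv_mid pi f L M = fdiv_mid pi f (dual pi L) M).
Proof.
have pi_neq0 x : pi x != 0 by rewrite lt0r_neq0 //; case: hpi.
split=> [|[_ balance]]; rewrite -fdiv_mid_dual //.
apply: eq_fdiv => // x y xy.
by rewrite (dual_reversible _ _ _ M).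
Qed.
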